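(* Let $b_1,\dots,b_{10}\in C^\infty(\mathbb{R})$ and consider the system on $T^*\mathbb{R}^2\equiv\mathbb{R}^4$ $$\begin{pmatrix}\dot q_1\\ \dot q_2\\ \dot p_1\\ \dot p_2\end{pmatrix}=\begin{pmatrix} b_1(t)&b_3(t)&b_8(t)&b_9(t)\\ b_2(t)&b_4(t)&b_9(t)&b_{10}(t)\\ -b_5(t)&-b_6(t)&-b_1(t)&-b_2(t)\\ -b_6(t)&-b_7(t)&-b_3(t)&-b_4(t)\end{pmatrix}\begin{pmatrix}q_1\\ q_2\\ p_1\\ p_2\end{pmatrix}.$$ Let $(q_1^{(\ell)},q_2^{(\ell)},p_1^{(\ell)},p_2^{(\ell)})$, $1\le\ell\le4$, be four particular solutions, and put $$L_{\alpha,\beta}^{(i,j)}=p_\alpha^{(i)}q_\beta^{(j)}-q_\alpha^{(i)}p_\beta^{(j)},\qquad 1\le\alpha,\beta\le2,\quad 1\le i,j\le4,$$ $$\Xi=L_{1,1}^{(1,3)}L_{2,2}^{(4,2)}+L_{1,1}^{(4,2)}L_{2,2}^{(1,3)}+L_{1,1}^{(2,1)}L_{2,2}^{(4,3)}+L_{1,1}^{(4,3)}L_{2,2}^{(2,1)}+L_{1,1}^{(3,2)}L_{2,2}^{(4,1)}+L_{1,1}^{(4,1)}L_{2,2}^{(3,2)}.$$ Then a superposition rule for the system, in terms of the four particular solutions and four significant constants $k_1,k_2,k_3,k_4$, is the following: the general solution $(q_1(t),q_2(t),p_1(t),p_2(t))$ is $$\begin{aligned} q_1(t)=\frac1\Xi\Big[&k_1\big(q_1^{(2)}L_{2,2}^{(4,3)}+q_1^{(3)}L_{2,2}^{(2,4)}+q_1^{(4)}L_{2,2}^{(3,2)}\big)+k_2\big(q_1^{(1)}L_{2,2}^{(3,4)}+q_1^{(3)}L_{2,2}^{(4,1)}+q_1^{(4)}L_{2,2}^{(1,3)}\big)\\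 &+k_3\big(q_1^{(1)}L_{2,2}^{(2,4)}+q_1^{(2)}L_{2,2}^{(4,1)}+q_1^{(4)}L_{2,2}^{(1,2)}\big)+k_4\big(q_1^{(1)}L_{2,2}^{(3,2)}+q_1^{(2)}L_{2,2}^{(1,3)}+q_1^{(3)}L_{2,2}^{(2,1)}\big)\Big],\\ q_2(t)=\frac1\Xi\Big[&k_1\big(q_2^{(2)}L_{1,1}^{(3,4)}+q_2^{(3)}L_{1,1}^{(4,2)}+q_2^{(4)}L_{1,1}^{(2,3)}\big)+k_2\big(q_2^{(1)}L_{1,1}^{(4,3)}+q_2^{(3)}L_{1,1}^{(1,4)}+q_2^{(4)}L_{1,1}^{(3,1)}\big)\\ &+k_3\big(q_2^{(1)}L_{1,1}^{(4,2)}+q_2^{(2)}L_{1,1}^{(1,4)}+q_2^{(4)}L_{1,1}^{(2,1)}\big)+k_4\big(q_2^{(1)}L_{1,1}^{(2,3)}+q_2^{(2)}L_{1,1}^{(3,1)}+q_2^{(3)}L_{1,1}^{(1,2)}\big)\Big],\\ p_1(t)=\frac1\Xi\Big[&k_1\big(p_1^{(2)}L_{2,2}^{(4,3)}+p_1^{(3)}L_{2,2}^{(2,4)}+p_1^{(4)}L_{2,2}^{(3,2)}\big)+k_2\big(p_1^{(1)}L_{2,2}^{(3,4)}+p_1^{(3)}L_{2,2}^{(4,1)}+p_1^{(4)}L_{2,2}^{(1,3)}\big)\\ &+k_3\big(p_1^{(1)}L_{2,2}^{(2,4)}+p_1^{(2)}L_{2,2}^{(4,1)}+p_1^{(4)}L_{2,2}^{(1,2)}\big)+k_4\big(p_1^{(1)}L_{2,2}^{(3,2)}+p_1^{(2)}L_{2,2}^{(1,3)}+p_1^{(3)}L_{2,2}^{(2,1)}\big)\Big],\\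 p_2(t)=\frac1\Xi\Big[&k_1\big(p_2^{(2)}L_{1,1}^{(3,4)}+p_2^{(3)}L_{1,1}^{(4,2)}+p_2^{(4)}L_{1,1}^{(2,3)}\big)+k_2\big(p_2^{(1)}L_{1,1}^{(4,3)}+p_2^{(3)}L_{1,1}^{(1,4)}+p_2^{(4)}L_{1,1}^{(3,1)}\big)\\ &+k_3\big(p_2^{(1)}L_{1,1}^{(4,2)}+p_2^{(2)}L_{1,1}^{(1,4)}+p_2^{(4)}L_{1,1}^{(2,1)}\big)+k_4\big(p_2^{(1)}L_{1,1}^{(2,3)}+p_2^{(2)}L_{1,1}^{(3,1)}+p_2^{(3)}L_{1,1}^{(1,2)}\big)\Big]. \end{aligned}$$ The constants come from the constants of the motion of the diagonal prolongation of the system, through $$-k_\ell^2=-\left(p_1^{(\ell)}q_1-p_1q_1^{(\ell)}+p_2^{(\ell)}q_2-p_2q_2^{(\ell)}\right)^2,\qquad 1\le\ell\le4.$$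
   Context: A superposition rule for a first-order ODE system is an expression of its general solution as a function of a finite number of particular solutions and of constants related to the initial conditions. The diagonal prolongation of the system to $(T^*\mathbb{R}^2)^5$ is the system consisting of five copies of it, one on each factor; a constant of the motion of it is a function on $(T^*\mathbb{R}^2)^5$ that is constant along its solutions. The system is the Lie--Hamilton system associated with the four-dimensional fundamental representation of the symplectic Lie algebra $\mathfrak{sp}(4,\mathbb{R})$, with respect to the symplectic form $\mathrm{d}q_1\wedge\mathrm{d}p_1+\mathrm{d}q_2\wedge\mathrm{d}p_2$.
   Formalization: The printed formulas for q_2 and p_2 have a sign error (with b_2=1 and all other b_j=0 they do not give solutions); the theorem proved has -1/Ξ in place of 1/Ξ in q_2 and p_2, and assumes Ξ nonzero at some time. *)

(* Defs.v *)
From HB Require Import structures.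
From mathcomp Require Import all_boot all_order all_algebra.
From mathcomp Require Import all_classical all_reals all_analysis.
Set Implicit Arguments.
Unset Strict Implicit.
Unset Printing Implicit Defensive.
Import Order.TTheory GRing.Theory Num.Theory numFieldNormedType.Exports.
Local Open Scope ring_scope.

(* Indices are 1-based as in the usual notation: [ith j] is the j-th element
   of 'I_n.+1, for 1 <= j <= n.+1 (out-of-range j is never used). *)
Definition ith {n : nat} (j : nat) : 'I_n.+1 := inord j.-1.

Definition smooth (R : realType) (f : R -> R) : Prop :=
  forall (n : nat) (t : R), derivable (derive1n n f) t 1.

(* T^*R^2: the column (q_1, q_2, p_1, p_2)^T. *)
Definition phase (R : realType) := 'cV[R]_(2 + 2).

Definition pos (R : realType) (z : phase R) (a : nat) : R :=
  z (lshift 2 (ith a)) 0.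

Definition mom (R : realType) (z : phase R) (a : nat) : R :=
  z (rshift 2 (ith a)) 0.

Definition sp4_mx (R : realType) (b : 'I_10 -> R -> R) (t : R) :
    'M[R]_(2 + 2) :=
  let c j := b (ith j) t in
  \matrix_(i, j) nth 0 (nth [::]
    [:: [:: c 1%N;     c 3%N;     c 8%N;     c 9%N   ];
        [:: c 2%N;     c 4%N;     c 9%N;     c 10%N  ];
        [:: - c 5%N; - c 6%N; - c 1%N; - c 2%N ];
        [:: - c 6%N; - c 7%N; - c 3%N; - c 4%N ]] i) j.

Definition sp4_solution (R : realType) (b : 'I_10 -> R -> R)
    (z : R -> phase R) : Prop :=
  forall t : R, is_derive t (1 : R) z (sp4_mx b t *m z t).

(* A function of m points is a constant of the motion of the diagonal
   prolongation to m copies when it is constant along every m-tuple of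
   solutions. *)
Definition constant_of_motion (R : realType) (M : Type)
    (sol : (R -> M) -> Prop) (m : nat) (F : ('I_m -> M) -> R) : Prop :=
  forall X : 'I_m -> R -> M, (forall l, sol (X l)) ->
  forall s t : R, F (X ^~ s) = F (X ^~ t).

(* Superposition rule for m generic particular solutions and r constants.
   Genericity is only required at one time; the first clause says that it then
   holds at all times.  The other two say that the rule gives the general
   solution: every value of the constants yields a solution, and every solution
   is obtained, for exactly one value of the constants. *)
Definition superposition_rule (R : realType) (M : Type)
    (sol : (R -> M) -> Prop) (m r : nat) (generic : ('I_m -> M) -> Prop)
    (Phi : ('I_m -> M) -> ('I_r -> R) -> M) : Prop :=
  forall x : 'I_m -> R -> M, (forall l, sol (x l)) ->
    (exists t0 : R, generic (x ^~ t0)) ->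
  [/\ forall t : R, generic (x ^~ t),
      forall k : 'I_r -> R, sol (fun t => Phi (x ^~ t) k)
    & forall y : R -> M, sol y ->
        exists! k : 'I_r -> R, forall t : R, y t = Phi (x ^~ t) k].

(* L_{a,c}^{(i,j)} *)
Definition angmom (R : realType) (x : 'I_4 -> phase R) (a c i j : nat) : R :=
  mom (x (ith i)) a * pos (x (ith j)) c - pos (x (ith i)) a * mom (x (ith j)) c.

(* Xi; it equals the determinant of the matrix with rows
   (p_1^{(l)}, q_1^{(l)}, p_2^{(l)}, q_2^{(l)}), so that Xi x != 0 means that
   the four points are linearly independent. *)
Definition Xi (R : realType) (x : 'I_4 -> phase R) : R :=
  let L11 := angmom x 1 1 in let L22 := angmom x 2 2 in
  L11 1%N 3%N * L22 4%N 2%N + L11 4%N 2%N * L22 1%N 3%N +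
  L11 2%N 1%N * L22 4%N 3%N + L11 4%N 3%N * L22 2%N 1%N +
  L11 3%N 2%N * L22 4%N 1%N + L11 4%N 1%N * L22 3%N 2%N.

(* The bracket in the formula for q_1 (with u i = q_1^{(i)}), and in the one
   for p_1 (with u i = p_1^{(i)}). *)
Definition bracket1 (R : realType) (x : 'I_4 -> phase R) (k : 'I_4 -> R)
    (u : nat -> R) : R :=
  let L22 := angmom x 2 2 in
  k (ith 1) * (u 2%N * L22 4%N 3%N + u 3%N * L22 2%N 4%N + u 4%N * L22 3%N 2%N)
+ k (ith 2) * (u 1%N * L22 3%N 4%N + u 3%N * L22 4%N 1%N + u 4%N * L22 1%N 3%N)
+ k (ith 3) * (u 1%N * L22 2%N 4%N + u 2%N * L22 4%N 1%N + u 4%N * L22 1%N 2%N)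
+ k (ith 4) * (u 1%N * L22 3%N 2%N + u 2%N * L22 1%N 3%N + u 3%N * L22 2%N 1%N).

(* The same for q_2 (u i = q_2^{(i)}) and p_2 (u i = p_2^{(i)}). *)
Definition bracket2 (R : realType) (x : 'I_4 -> phase R) (k : 'I_4 -> R)
    (u : nat -> R) : R :=
  let L11 := angmom x 1 1 in
  k (ith 1) * (u 2%N * L11 3%N 4%N + u 3%N * L11 4%N 2%N + u 4%N * L11 2%N 3%N)
+ k (ith 2) * (u 1%N * L11 4%N 3%N + u 3%N * L11 1%N 4%N + u 4%N * L11 3%N 1%N)
+ k (ith 3) * (u 1%N * L11 4%N 2%N + u 2%N * L11 1%N 4%N + u 4%N * L11 2%N 1%N)
+ k (ith 4) * (u 1%N * L11 2%N 3%N + u 2%N * L11 3%N 1%N + u 3%N * L11 1%N 2%N).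

(* The point (q_1, q_2, p_1, p_2)^T given by the superposition formula.

   Sign: the published formula has 1/Xi in all four components.  With that sign
   it is not a superposition rule: it returns (q_1, - q_2, p_1, - p_2) where
   (q_1, q_2, p_1, p_2) is a solution, and this is not a solution in general
   (e.g. if b_2 = 1 and the other coefficients vanish).  Solving
   k_l^2 = (p_1^{(l)} q_1 - p_1 q_1^{(l)} + p_2^{(l)} q_2 - p_2 q_2^{(l)})^2,
   the components q_1, p_1 force the signs (-, -, +, +) of the roots
   k_1, ..., k_4, while q_2, p_2 force (+, +, -, -).  The sign of q_2 and p_2
   is therefore reversed here; reversing q_1 and p_1 instead amounts to
   replacing k by - k. *)
Definition sp4_rule (R : realType) (x : 'I_4 -> phase R) (k : 'I_4 -> R) :
    phase R :=
  let q a i := pos (x (ith i)) a in let p a i := mom (x (ith i)) a in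
  \col_i nth 0
    [:: (Xi x)^-1 * bracket1 x k (q 1%N);
        - (Xi x)^-1 * bracket2 x k (q 2%N);
        (Xi x)^-1 * bracket1 x k (p 1%N);
        - (Xi x)^-1 * bracket2 x k (p 2%N)] i.

(* p_1^{(l)} q_1 - p_1 q_1^{(l)} + p_2^{(l)} q_2 - p_2 q_2^{(l)}, where z is
   the l-th particular solution and y the general one. *)
Definition pairing (R : realType) (z y : phase R) : R :=
  mom z 1 * pos y 1 - mom y 1 * pos z 1 + mom z 2 * pos y 2 - mom y 2 * pos z 2.

(* Main.v *)
Require Import Defs.
From mathcomp Require Import all_boot all_order all_algebra.
From mathcomp Require Import all_classical all_reals all_analysis.
From mathcomp Require Import ring.
Import Order.TTheory GRing.Theory Num.Theory numFieldNormedType.Exports.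
Local Open Scope ring_scope.

(** The symplectic pairing w of two solutions is constant, because sp(4)
    matrices are skew for it.  By the Pluecker relations, which kill the pure
    L11 and L22 parts, Xi is up to sign the Pfaffian of the Gram matrix
    (w (x_i, x_j)), and the rule is a linear combination of the x_m whose
    coefficients are w (x_i, x_j) k_l / Xi.  Hence Xi and these coefficients are
    constant, and the rule yields solutions.  Conversely, a point is determined
    by its pairings with x_1, ..., x_4, and the pairing of x_l with the value of
    the rule is k_l up to a fixed sign. *)

Lemma is_derive_entry (R : realType) (m n : nat) (M : R -> 'M[R]_(m, n))
    (t : R) (D : 'M[R]_(m, n)) (i : 'I_m) (j : 'I_n) :
  is_derive t (1 : R) M D -> is_derive t (1 : R) (fun u => M u i j) (D i j).
Proof.
move=> [dM <-]; split; first by move/derivable_mxP: dM.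
by rewrite derive_mx // mxE.
Qed.

Lemma ith_ord (n j : nat) (i : 'I_n.+1) : (i : nat) = j.-1 -> @ith n j = i.
Proof. by move=> ij; apply: val_inj; rewrite /ith /= -ij inord_val. Qed.

Lemma phaseP (R : realType) (z w : phase R) :
  pos z 1 = pos w 1 -> pos z 2 = pos w 2 ->
  mom z 1 = mom w 1 -> mom z 2 = mom w 2 -> z = w.
Proof.
rewrite /pos /mom !(@ith_ord 1 1 ord0) // !(@ith_ord 1 2 ord_max) //.
move=> q1 q2 p1 p2; apply/colP => i.
(* Each entry is covered by one hypothesis, up to the proof of the bound carried by the ordinal. *)
case: (split_ordP i) => [] [[|[|//]] j] ->;
  [move: q1 | move: q2 | move: p1 | move: p2];
  by congr (z _ _ = w _ _); apply: val_inj.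
Qed.

Section Linear.
Variables (R : realType) (z w : phase R) (c : R) (a : nat).

Lemma posD : pos (z + w) a = pos z a + pos w a. Proof. by rewrite /pos mxE. Qed.
Lemma momD : mom (z + w) a = mom z a + mom w a. Proof. by rewrite /mom mxE. Qed.
Lemma posZ : pos (c *: z) a = c * pos z a. Proof. by rewrite /pos mxE. Qed.
Lemma momZ : mom (c *: z) a = c * mom z a. Proof. by rewrite /mom mxE. Qed.

End Linear.

Lemma pos1_sp4_mx (R : realType) (b : 'I_10 -> R -> R) t (z : phase R) :
  pos (sp4_mx b t *m z) 1 = b (ith 1) t * pos z 1 + b (ith 3) t * pos z 2
    + b (ith 8) t * mom z 1 + b (ith 9) t * mom z 2.
Proof.
rewrite /pos /mom !(@ith_ord 1 1 ord0) // !(@ith_ord 1 2 ord_max) // mxE.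
rewrite big_split_ord !big_ord_recr !big_ord0 /= !mxE /= !add0r addrA.
by congr (_ * z _ _ + _ * z _ _ + _ * z _ _ + _ * z _ _); apply: val_inj.
Qed.

Lemma pos2_sp4_mx (R : realType) (b : 'I_10 -> R -> R) t (z : phase R) :
  pos (sp4_mx b t *m z) 2 = b (ith 2) t * pos z 1 + b (ith 4) t * pos z 2
    + b (ith 9) t * mom z 1 + b (ith 10) t * mom z 2.
Proof.
rewrite /pos /mom !(@ith_ord 1 1 ord0) // !(@ith_ord 1 2 ord_max) // mxE.
rewrite big_split_ord !big_ord_recr !big_ord0 /= !mxE /= !add0r addrA.
by congr (_ * z _ _ + _ * z _ _ + _ * z _ _ + _ * z _ _); apply: val_inj.
Qed.

Lemma mom1_sp4_mx (R : realType) (b : 'I_10 -> R -> R) t (z : phase R) :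
  mom (sp4_mx b t *m z) 1 = - b (ith 5) t * pos z 1 + - b (ith 6) t * pos z 2
    + - b (ith 1) t * mom z 1 + - b (ith 2) t * mom z 2.
Proof.
rewrite /pos /mom !(@ith_ord 1 1 ord0) // !(@ith_ord 1 2 ord_max) // mxE.
rewrite big_split_ord !big_ord_recr !big_ord0 /= !mxE /= !add0r addrA.
by congr (_ * z _ _ + _ * z _ _ + _ * z _ _ + _ * z _ _); apply: val_inj.
Qed.

Lemma mom2_sp4_mx (R : realType) (b : 'I_10 -> R -> R) t (z : phase R) :
  mom (sp4_mx b t *m z) 2 = - b (ith 6) t * pos z 1 + - b (ith 7) t * pos z 2
    + - b (ith 3) t * mom z 1 + - b (ith 4) t * mom z 2.
Proof.
rewrite /pos /mom !(@ith_ord 1 1 ord0) // !(@ith_ord 1 2 ord_max) // mxE.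
rewrite big_split_ord !big_ord_recr !big_ord0 /= !mxE /= !add0r addrA.
by congr (_ * z _ _ + _ * z _ _ + _ * z _ _ + _ * z _ _); apply: val_inj.
Qed.

Lemma pairing_skew_sp4 (R : realType) (b : 'I_10 -> R -> R) t (z y : phase R) :
  pairing (sp4_mx b t *m z) y + pairing z (sp4_mx b t *m y) = 0.
Proof.
rewrite /pairing !pos1_sp4_mx !pos2_sp4_mx !mom1_sp4_mx !mom2_sp4_mx; ring.
Qed.

Lemma is_derive_pairing (R : realType) (z y : R -> phase R) (t : R)
    (dz dy : phase R) :
  is_derive t (1 : R) z dz -> is_derive t (1 : R) y dy ->
  is_derive t (1 : R) (fun u => pairing (z u) (y u))
    (pairing dz (y t) + pairing (z t) dy).
Proof.
move=> Dz Dy.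
have q a := is_derive_entry _ _ _ _ _ _ (lshift 2 (ith a)) 0 Dz.
have p a := is_derive_entry _ _ _ _ _ _ (rshift 2 (ith a)) 0 Dz.
have q' a := is_derive_entry _ _ _ _ _ _ (lshift 2 (ith a)) 0 Dy.
have p' a := is_derive_entry _ _ _ _ _ _ (rshift 2 (ith a)) 0 Dy.
(* The rules are nested exactly as the terms of [pairing]; only the value of the derivative then has
   to be rearranged. *)
have := is_deriveB (is_deriveD (is_deriveB (is_deriveM (p 1%N) (q' 1%N))
  (is_deriveM (p' 1%N) (q 1%N))) (is_deriveM (p 2%N) (q' 2%N)))
  (is_deriveM (p' 2%N) (q 2%N)).
move=> /is_derive_eq; apply.
rewrite /pairing /pos /mom /GRing.scale /=; ring.
Qed.

Lemma pairing_const (R : realType) (b : 'I_10 -> R -> R) (z y : R -> phase R) :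
  sp4_solution b z -> sp4_solution b y ->
  forall s t : R, pairing (z s) (y s) = pairing (z t) (y t).
Proof.
move=> hz hy s t; apply: (@is_derive_0_is_cst R (fun u => pairing (z u) (y u))) => u.
by rewrite -(pairing_skew_sp4 R b u (z u) (y u)); apply: is_derive_pairing.
Qed.

Lemma sp4_solutionD (R : realType) (b : 'I_10 -> R -> R) (z w : R -> phase R) :
  sp4_solution b z -> sp4_solution b w -> sp4_solution b (fun t => z t + w t).
Proof. by move=> hz hw t; rewrite mulmxDr; apply: is_deriveD. Qed.

Lemma sp4_solutionZ (R : realType) (b : 'I_10 -> R -> R) (c : R)
    (z : R -> phase R) :
  sp4_solution b z -> sp4_solution b (fun t => c *: z t).
Proof. by move=> hz t; rewrite -scalemxAr; apply: is_deriveZ. Qed.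

Section Rule.
Variables (R : realType) (x : 'I_4 -> phase R) (k : 'I_4 -> R).

Let w i j := pairing (x (ith i)) (x (ith j)).

Lemma Xi_pfaffian :
  Xi x = w 1%N 3%N * w 4%N 2%N + w 2%N 1%N * w 4%N 3%N + w 3%N 2%N * w 4%N 1%N.
Proof. rewrite /w /Xi /angmom /pairing; ring. Qed.

Lemma pos1_sp4_rule : pos (sp4_rule x k) 1 =
  (Xi x)^-1 * bracket1 x k (fun i => pos (x (ith i)) 1).
Proof. by rewrite {1}/pos mxE !(@ith_ord 1 1 ord0). Qed.

Lemma pos2_sp4_rule : pos (sp4_rule x k) 2 =
  - (Xi x)^-1 * bracket2 x k (fun i => pos (x (ith i)) 2).
Proof. by rewrite {1}/pos mxE !(@ith_ord 1 2 ord_max). Qed.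

Lemma mom1_sp4_rule : mom (sp4_rule x k) 1 =
  (Xi x)^-1 * bracket1 x k (fun i => mom (x (ith i)) 1).
Proof. by rewrite {1}/mom mxE !(@ith_ord 1 1 ord0). Qed.

Lemma mom2_sp4_rule : mom (sp4_rule x k) 2 =
  - (Xi x)^-1 * bracket2 x k (fun i => mom (x (ith i)) 2).
Proof. by rewrite {1}/mom mxE !(@ith_ord 1 2 ord_max). Qed.

Definition sp4_ruleE :=
  (pos1_sp4_rule, pos2_sp4_rule, mom1_sp4_rule, mom2_sp4_rule).

(** Any three plane vectors satisfy u L(v,w) + v L(w,u) + w L(u,v) = 0. So in the components [q_1],
    [p_1] the L11 part of each [w] cancels and L22 remains, and conversely in [q_2], [p_2]. One set
    of coefficients thus serves all four components, thanks to the minus sign in [sp4_rule]. *)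
Lemma sp4_rule_combination : sp4_rule x k = (Xi x)^-1 *: (
    (k (ith 2) * w 3%N 4%N + k (ith 3) * w 2%N 4%N + k (ith 4) * w 3%N 2%N)
      *: x (ith 1)
  + (k (ith 1) * w 4%N 3%N + k (ith 3) * w 4%N 1%N + k (ith 4) * w 1%N 3%N)
      *: x (ith 2)
  + (k (ith 1) * w 2%N 4%N + k (ith 2) * w 4%N 1%N + k (ith 4) * w 2%N 1%N)
      *: x (ith 3)
  + (k (ith 1) * w 3%N 2%N + k (ith 2) * w 1%N 3%N + k (ith 3) * w 1%N 2%N)
      *: x (ith 4)).
Proof.
apply: phaseP; rewrite sp4_ruleE !(posD, momD, posZ, momZ);
  rewrite /w /bracket1 /bracket2 /angmom /pairing; move: (_^-1) => v; ring.
Qed.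

(** The choice of square roots, (-, -, +, +); ordinals 0 and 1 are the solutions numbered 1 and
    2. *)
Definition rule_sign (l : 'I_4) : R := if (l < 2)%N then -1 else 1.

Lemma rule_sign_sqr l : rule_sign l ^+ 2 = 1.
Proof. by rewrite /rule_sign; case: ifP; rewrite ?sqrrN expr1n. Qed.

(** This is Cramer's rule: up to sign, the brackets are sums of [k l] times 3 by 3 minors of the
    linear system that prescribes the four pairings, and [Xi x] is its determinant. *)
Lemma pairing_sp4_rule (l : 'I_4) : Xi x != 0 ->
  pairing (x l) (sp4_rule x k) = rule_sign l * k l.
Proof.
(* With the factor [(Xi x)^-1] on both sides, the inverse can be generalized to [v], which leaves
   polynomial identities. *)
move=> x0; rewrite -[RHS](mulKf x0) /pairing !sp4_ruleE.
have ithE (i : 'I_4) : i = ith i.+1 by rewrite (ith_ord _ _ i).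
rewrite (ithE l) /rule_sign.
case: l => [[|[|[|[|//]]]] hl] /=; rewrite inordK //=;
  rewrite /Xi /bracket1 /bracket2 /angmom; move: (_^-1) => v; ring.
Qed.

End Rule.

Lemma sp4_rule_pairing (R : realType) (x : 'I_4 -> phase R) (y : phase R) :
  Xi x != 0 -> sp4_rule x (fun l => rule_sign R l * pairing (x l) y) = y.
Proof.
move=> x0; apply: phaseP; rewrite sp4_ruleE -[RHS](mulKf x0);
  rewrite /bracket1 /bracket2 /rule_sign /ith !inordK //= /Xi /angmom /pairing;
  move: (_^-1) => v; ring.
Qed.

Lemma Xi_const (R : realType) (b : 'I_10 -> R -> R) (x : 'I_4 -> R -> phase R) :
  (forall l, sp4_solution b (x l)) -> forall s t : R, Xi (x ^~ s) = Xi (x ^~ t).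
Proof.
move=> hx s t; rewrite !Xi_pfaffian.
by congr (_ * _ + _ * _ + _ * _); apply: pairing_const.
Qed.

Theorem mainTheorem6 (R : realType) (b : 'I_10 -> R -> R)
    (b_smooth : forall j : 'I_10, smooth (b j)) :
  [/\ (* the superposition rule *)
      superposition_rule (sp4_solution b)
        (fun x : 'I_4 -> phase R => Xi x != 0) (@sp4_rule R),
      (* the constants of the motion on five copies; the fifth copy carries
         the general solution *)
      forall l : nat, (1 <= l <= 4)%N ->
        constant_of_motion (sp4_solution b)
          (fun X : 'I_5 -> phase R => - pairing (X (ith l)) (X (ith 5)) ^+ 2)
    & (* the constants of the rule come from them *)
      forall (x : 'I_4 -> R -> phase R) (y : R -> phase R) (k : 'I_4 -> R),
        (forall l, sp4_solution b (x l)) ->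
        (exists t0 : R, Xi (x ^~ t0) != 0) ->
        sp4_solution b y ->
        (forall t : R, y t = sp4_rule (x ^~ t) k) ->
        forall l : nat, (1 <= l <= 4)%N ->
        forall t : R, - k (ith l) ^+ 2 = - pairing (x (ith l) t) (y t) ^+ 2].
Proof.
split.
- move=> x hx [t0 gen0].
  have gen t : Xi (x ^~ t) != 0 by rewrite (Xi_const R b x hx t t0).
  have const i j t := pairing_const R b _ _ (hx i) (hx j) t t0.
  split=> // [k | y hy].
    (* Once all scalars are frozen at [t0], the rule is a fixed linear combination of solutions. *)
    under eq_fun do rewrite sp4_rule_combination (Xi_const R b x hx _ t0) !const.
    by apply: sp4_solutionZ; do !apply: sp4_solutionD; apply: sp4_solutionZ.
  (* The signs are their own inverses, so this inverts [pairing_sp4_rule]; time 0 is arbitrary since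
     pairings are constant. *)
  exists (fun l => rule_sign R l * pairing (x l 0) (y 0)); split=> [t | k hk].
    rewrite -[LHS](sp4_rule_pairing R _ (y t) (gen t)); congr sp4_rule.
    by apply/funext => l; rewrite (pairing_const R b _ _ (hx l) hy t 0).
  (* Uniqueness: pairing with [x l] at time 0 reads off [k l] up to its sign. *)
  apply/funext => l; rewrite (hk 0) (pairing_sp4_rule R (x ^~ 0)) //.
  by rewrite mulrA -expr2 rule_sign_sqr mul1r.
- by move=> l _ X hX s t; congr (- _ ^+ 2); apply: pairing_const.
move=> x y k hx [t0 gen0] hy yE l _ t; rewrite yE.
(* Squaring removes the sign. *)
rewrite (pairing_sp4_rule R (x ^~ t)) ?exprMn ?rule_sign_sqr ?mul1r //.
by rewrite (Xi_const R b x hx t t0).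
Qed.
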